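(* Let $S$ be a compact, connected, non-positively curved special cube complex, $\Gamma$ its fundamental group, $X$ its universal covering (a CAT(0) cube complex), and $\ell$ a $\Gamma$-invariant admissible edge labeling on $X$. Suppose there exists some $o\in X^{(0)}$ such that for all reduced words $v\in\mathcal L_o^{cube}\setminus\{\epsilon\}$, every label-morphism $\sigma:\Sigma_{0,v}\to\Sigma_0$ that is compatible with $v$ also appears at $v$ in $G_o$. Then exactly one of the following holds: (1) $\mathrm{Aut}(X)$ is finitely generated, and furthermore all vertex-stabilizers in $\mathrm{Aut}(X)$ are finite. (2) $\mathrm{Aut}(X)$ is non-discrete. In particular, the vertex-stabilizers are either (all) uncountable or (all) finite.
   Context: $\mathrm{Aut}(X)$ is the group of cubical automorphisms of $X$ with the compact-open topology; $G_o$ is the stabilizer of $o$ in $\mathrm{Aut}(X)$. ''Special'' is in the sense of Haglund--Wise (hyperplanes are embedded and two-sided, do not directly self-osculate, and do not inter-osculate). Labelings. $\vec{\mathcal E}(X)$ is the set of oriented edges, $\vec{\mathcal E}(X)_v$ those starting at $v$. Oriented edges are parallel if they cross the same hyperplane in the same direction. Two edges with exactly one common endpoint span a square if they are two sides of a common square. An admissible edge labeling is a map $\ell:\vec{\mathcal E}(X)\to\Sigma_0$ to a finite set $\Sigma_0$ with fixpoint-free involution $s\mapsto s^{-1}$ such that: (A1) parallel oriented edges have equal labels and reversing orientation inverts the label; (A2) $\ell|_{\vec{\mathcal E}(X)_v}$ is injective for each vertex $v$; (A3) if $e_1,e_2\in\vec{\mathcal E}(X)_v$, $e_1',e_2'\in\vec{\mathcal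 E}(X)_w$ with $\ell(e_i)=\ell(e_i')$ for $i=1,2$, then $e_1,e_2$ span a square iff $e_1',e_2'$ do. It is $\Gamma$-invariant if $\ell(g(e))=\ell(e)$ for all $g\in\Gamma$ and all $e$. Labels and words. $\Sigma_{0,v}=\ell(\vec{\mathcal E}(X)_v)$. Labels $s,t\in\Sigma_0$ commute, $[s,t]=1$, if at some vertex there are outgoing edges labeled $s$ and $t$ spanning a square; otherwise $[s,t]\ne1$. $\Sigma$ is the set of nonempty subsets of $\Sigma_0$ whose distinct elements commute pairwise; $s\in\Sigma_0$ is identified with $\{s\}$. An oriented diagonal is an ordered pair of opposite vertices $(v,w)$ of a cube $C$ of dimension $\ge1$; its label is the set of labels of the edges of $C$ starting at $v$. $\Sigma_v\subset\Sigma$ is the set of labels of oriented diagonals starting at $v$. For $\alpha,\beta\in\Sigma_v$, $[\alpha,\beta]=1$ means every $s\in\alpha$ commutes with every $t\in\beta$. A cube path is a finite concatenation of oriented diagonals; its word is the sequence of labels. $\mathcal L_o^{cube}\subset\Sigma^*$ is the set of words of cube paths starting at $o$ (each word determines its path); $\epsilon$ is the empty word. A word $v\in\mathcal L_o^{cube}$ is also used to denote the endpoint of its path, and $\Sigma_v,\Sigma_{0,v}$ refer to this endpoint. A word is reduced if its path crosses no hyperplane more than once, reducible otherwise. Label-morphism: an injective map $\sigma:\Sigma_{0,v}\to\Sigma_0$ with $[s,t]=1\Leftrightarrow[\sigma(s),\sigma(t)]=1$ for all $s,t\in\Sigma_{0,v}$, extended to $\Sigma_v$ by $\sigma(\{s_1,\dots,s_n\})=\{\sigma(s_1),\dots,\sigma(s_n)\}$.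 The notation $\sigma(\alpha)=\alpha$ means $\sigma(s)=s$ for every $s\in\alpha$. Compatible: for a reduced word $v\neq\epsilon$, $\sigma$ is compatible with $v$ if for every $\alpha\in\Sigma_v$ such that $v\alpha$ is reducible we have $\sigma(\alpha)=\alpha$, and moreover $\sigma(\beta)=\beta$ for every $\beta\in\Sigma_v$ with $[\alpha,\beta]=1$. Portrait: for $g\in G_o$ and a vertex $v$, ${}_{v}\sigma(g):\Sigma_v\to\Sigma_{g(v)}$ sends the label of an outgoing diagonal $d$ at $v$ to the label of $g(d)$. Types: for a vertex $v\ne o$ let $\hat h_1,\dots,\hat h_n$ be the hyperplanes that intersect an edge incident to $v$ and separate $o$ from $v$, and $h_i$ the halfspace of $\hat h_i$ containing $v$. A vertex $w$ is of Type 1 relative to $(o,v)$ if $w\notin h_1\cap\dots\cap h_n$; of Type 2 if $w\in h_1\cap\dots\cap h_n$ and $w$ lies in the carrier of some $\hat h_i$ (the union of cubes meeting $\hat h_i$); of Type 3 otherwise. Appears: for $v\neq o$, a label-morphism $\sigma:\Sigma_{0,v}\to\Sigma_0$ appears at $v$ in $G_o$ if there is $g\in G_o$ with ${}_{v}\sigma(g)=\sigma$ which fixes all vertices of Type 1 and Type 2 relative to $(o,v)$. *)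

(* Defs.v *)
From HB Require Import structures.
From Stdlib Require List.
From Stdlib Require Import Relation_Operators.
From mathcomp Require Import all_boot all_order all_algebra.
From mathcomp Require Import all_classical all_reals all_analysis.
Import numFieldNormedType.Exports.

Set Implicit Arguments.
Unset Strict Implicit.
Unset Printing Implicit Defensive.

Import Order.TTheory GRing.Theory Num.Theory.
Local Open Scope classical_set_scope.
Local Open Scope ring_scope.

(* An isometric identification of I^m with an m-dimensional face of I^n: it
   sends the vertex 0 to the vertex [cm_base] and the i-th coordinate direction
   to the [cm_dir i]-th one.  For m = n these are the symmetries of I^n. *)
Record cubemap (m n : nat) := Cubemap {
  cm_base : {ffun 'I_n -> bool};
  cm_dir : {ffun 'I_m -> 'I_n};
  cm_inj : injectiveb cm_dir }.

Definition cm_vertex m n (f : cubemap m n) (x : {ffun 'I_m -> bool}) :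
    {ffun 'I_n -> bool} :=
  [ffun j => cm_base f j (+) [exists i, (cm_dir f i == j) && x i]].

Definition cm_point (R : realType) m n (f : cubemap m n) (x : 'rV[R]_m) :
    'rV[R]_n :=
  \row_j if [pick i | cm_dir f i == j] is Some i
         then (if cm_base f j then 1 - x 0 i else x 0 i)
         else (cm_base f j)%:R.

Lemma id_dir_inj n : injectiveb [ffun i : 'I_n => i].
Proof. by apply/injectiveP => i j; rewrite !ffunE. Qed.

Definition cm_id n : cubemap n n := Cubemap [ffun => false] (id_dir_inj n).

Lemma comp_dir_inj k m n (f : cubemap m n) (g : cubemap k m) :
  injectiveb [ffun i => cm_dir f (cm_dir g i)].
Proof.
apply/injectiveP => i j; rewrite !ffunE.
by move=> /(injectiveP _ (cm_inj f)) /(injectiveP _ (cm_inj g)).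
Qed.

Definition cm_comp k m n (f : cubemap m n) (g : cubemap k m) : cubemap k n :=
  Cubemap (cm_vertex f (cm_base g)) (comp_dir_inj f g).

Lemma vtx_dir_inj n (f : {ffun 'I_0 -> 'I_n}) : injectiveb f.
Proof. by apply/injectiveP => -[]. Qed.

Definition cm_vtx n (x : {ffun 'I_n -> bool}) : cubemap 0 n :=
  @Cubemap 0 n x (ffun0 (card_ord 0)) (vtx_dir_inj _).

Lemma edge_dir_inj n (i : 'I_n) : injectiveb [ffun _ : 'I_1 => i].
Proof. by apply/injectiveP => a b _; rewrite !ord1. Qed.

Definition cm_edge n (x : {ffun 'I_n -> bool}) (i : 'I_n) : cubemap 1 n :=
  Cubemap x (edge_dir_inj i).

(* [cube n] is the set of n-cubes together with a parametrization by I^n, that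
   is, of characteristic maps I^n -> X, so an n-cube is an orbit of the
   symmetries of I^n on [cube n].  Cubes need not be embedded: different faces
   of a cube may be identified, but by [face_free] no cube is folded. *)
Record cube_complex := CubeComplex {
  cube : nat -> Type;
  face : forall m n, cubemap m n -> cube n -> cube m;
  face_id : forall n (c : cube n), face (cm_id n) c = c;
  face_comp : forall k m n (f : cubemap m n) (g : cubemap k m) (c : cube n),
    face (cm_comp f g) c = face g (face f c);
  face_free : forall n (f : cubemap n n) (c : cube n), face f c = c -> f = cm_id n }.

Definition vertex (X : cube_complex) := cube X 0.
(* A parametrized 1-cube is an oriented edge. *)
Definition edge (X : cube_complex) := cube X 1.

Section Edges.
Variable X : cube_complex.

Definition corner n (c : cube X n) : vertex X := face (cm_vtx [ffun => false]) c.
Definition opposite_corner n (c : cube X n) : vertex X :=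
  face (cm_vtx [ffun => true]) c.
Definition start (e : edge X) : vertex X := corner e.
Definition finish (e : edge X) : vertex X := opposite_corner e.
Definition rev_edge (e : edge X) : edge X := face (cm_edge [ffun => true] ord0) e.

Definition axis n (c : cube X n) (i : 'I_n) : edge X :=
  face (cm_edge [ffun => false] i) c.

(* The four sides of a parametrized square; [left] and [right] (resp. [bottom]
   and [top]) are opposite and point in the same direction. *)
Definition sq_bottom (c : cube X 2) : edge X := axis c ord0.
Definition sq_left (c : cube X 2) : edge X := axis c ord_max.
Definition sq_top (c : cube X 2) : edge X :=
  face (cm_edge [ffun j => j == ord_max] ord0) c.
Definition sq_right (c : cube X 2) : edge X :=
  face (cm_edge [ffun j => j == ord0] ord_max) c.

Definition edge_of n (c : cube X n) (e : edge X) : Prop :=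
  exists f : cubemap 1 n, e = face f c.
Definition vertex_of n (c : cube X n) (v : vertex X) : Prop :=
  exists f : cubemap 0 n, v = face f c.

Fixpoint edge_path (v : vertex X) (s : seq (edge X)) (w : vertex X) : Prop :=
  if s is e :: s' then start e = v /\ edge_path (finish e) s' w else v = w.

(* Elementary homotopies of edge paths starting at [v]: removing a backtrack,
   or pushing the path across a square. *)
Inductive homotopy_step (v : vertex X) : seq (edge X) -> seq (edge X) -> Prop :=
| Backtrack s t e w :
    edge_path v (s ++ [:: e; rev_edge e] ++ t) w -> edge_path v (s ++ t) w ->
    homotopy_step v (s ++ [:: e; rev_edge e] ++ t) (s ++ t)
| PushSquare s t (c : cube X 2) w :
    edge_path v (s ++ [:: sq_bottom c; sq_right c] ++ t) w ->
    edge_path v (s ++ [:: sq_left c; sq_top c] ++ t) w ->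
    homotopy_step v (s ++ [:: sq_bottom c; sq_right c] ++ t)
                    (s ++ [:: sq_left c; sq_top c] ++ t).

Definition homotopic (v : vertex X) := clos_refl_sym_trans _ (homotopy_step v).

Definition simply_connected : Prop :=
  (forall v w, exists s, edge_path v s w) /\
  (forall v s, edge_path v s v -> homotopic v s [::]).

Definition elementary_parallel (e f : edge X) : Prop :=
  exists c : cube X 2, e = sq_bottom c /\ f = sq_top c.

(* Equality of the dual hyperplanes and of the directions in which they are
   crossed. *)
Definition parallel := clos_refl_sym_trans _ elementary_parallel.

(* A hyperplane is a class of unoriented edges; it is represented throughout by
   any oriented edge dual to it. *)
Definition same_hyperplane (e f : edge X) : Prop :=
  parallel e f \/ parallel e (rev_edge f).

Definition square_corner (e f : edge X) : Prop :=
  exists c : cube X 2, axis c ord0 = e /\ axis c ord_max = f.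

(* Gromov's link condition: the link of every vertex, whose vertices are the
   oriented edges starting there and whose simplices are the corners of cubes,
   is a flag simplicial complex. *)
Definition nonpositively_curved : Prop :=
  [/\ forall n (c : cube X n), injective (axis c),
      forall n (c d : cube X n), corner c = corner d -> axis c =1 axis d -> c = d &
      forall n (v : vertex X) (e : 'I_n -> edge X),
        (forall i, start (e i) = v) -> injective e ->
        (forall i j, i != j -> square_corner (e i) (e j)) ->
        exists c : cube X n, corner c = v /\ axis c =1 e].

Definition hyperplanes_embedded : Prop :=
  forall e f, square_corner e f -> ~ same_hyperplane e f.

Definition hyperplanes_two_sided : Prop := forall e, ~ parallel e (rev_edge e).

(* Sharing the terminal vertex instead is covered by reversing both edges. *)
Definition directly_self_osculates (h : edge X) : Prop :=
  exists e f, [/\ parallel h e, parallel h f, start e = start f, e <> f &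
                  ~ square_corner e f].

Definition hyperplanes_cross (h k : edge X) : Prop :=
  exists e f, [/\ same_hyperplane h e, same_hyperplane k f & square_corner e f].

Definition hyperplanes_osculate (h k : edge X) : Prop :=
  exists e f, [/\ same_hyperplane h e, same_hyperplane k f, start e = start f &
                  ~ square_corner e f].

Definition special : Prop :=
  [/\ hyperplanes_embedded, hyperplanes_two_sided,
      forall h, ~ directly_self_osculates h &
      forall h k, ~ same_hyperplane h k ->
        ~ (hyperplanes_cross h k /\ hyperplanes_osculate h k)].

(* The halfspace of [h] containing [v] is [same_side h v]: the vertices joined to
   [v] by an edge path that does not cross [h]. *)
Definition same_side (h : edge X) (v w : vertex X) : Prop :=
  exists2 s, edge_path v s w & List.Forall (fun e => ~ same_hyperplane h e) s.

Definition separates (h : edge X) (v w : vertex X) : Prop := ~ same_side h v w.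

Definition carrier (h : edge X) : set (vertex X) :=
  [set w | exists n (c : cube X n),
     vertex_of c w /\ exists2 e, edge_of c e & same_hyperplane h e].

(* The hyperplanes meeting an edge incident to [v] and separating [o] from [v],
   given by their dual edges that start at [v]. *)
Definition back_hyperplane (o v : vertex X) (h : edge X) : Prop :=
  start h = v /\ separates h o v.

Definition type1 (o v w : vertex X) : Prop :=
  exists2 h, back_hyperplane o v h & ~ same_side h v w.

Definition type2 (o v w : vertex X) : Prop :=
  (forall h, back_hyperplane o v h -> same_side h v w) /\
  (exists2 h, back_hyperplane o v h & carrier h w).

End Edges.

Definition cell (X : cube_complex) := {n : nat & cube X n}.
HB.instance Definition _ X := gen_eqMixin (cell X).
HB.instance Definition _ X := gen_choiceMixin (cell X).

Definition unit_cube (R : realType) (n : nat) : set 'rV[R]_n :=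
  [set x | forall i, 0 <= x 0 i <= 1].
Arguments unit_cube : clear implicits.

Section Realization.
Variables (R : realType) (X : cube_complex).

(* The disjoint union of the parametrized cubes, with [cube X n] discrete. *)
Definition cell_points : Type := {c : cell X & unit_cube R (tag c)}.
HB.instance Definition _ := Topological.on cell_points.

Definition cell_point n (c : cube X n) (x : unit_cube R n) : cell_points :=
  existT (fun c : cell X => unit_cube R (tag c) : Type) (existT _ n c) x.

Inductive face_glue : cell_points -> cell_points -> Prop :=
| FaceGlue m n (f : cubemap m n) (c : cube X n) (x : unit_cube R m) (y : unit_cube R n) :
    val y = cm_point f (val x) -> face_glue (cell_point (face f c) x) (cell_point c y).

Definition glued (p q : cell_points) : bool :=
  `[< clos_refl_sym_trans _ face_glue p q >].

Lemma glued_refl : reflexive glued.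
Proof. by move=> p; apply/asboolP; exact: rst_refl. Qed.
Lemma glued_sym : symmetric glued.
Proof. by move=> p q; apply: asbool_equiv_eq; split; exact: rst_sym. Qed.
Lemma glued_trans : transitive glued.
Proof.
by move=> q p r /asboolP pq /asboolP qr; apply/asboolP; exact: (rst_trans _ _ _ q).
Qed.
Canonical glued_equiv := EquivRel glued glued_refl glued_sym glued_trans.

Definition realization : Type := quotient_topology {eq_quot glued_equiv}%qT.
HB.instance Definition _ := Topological.on realization.
HB.instance Definition _ := Quotient.on realization.

End Realization.

Record cubical_map (X Y : cube_complex) := CubicalMap {
  cmap :> forall n, cube X n -> cube Y n;
  cmap_face : forall m n (f : cubemap m n) (c : cube X n),
    cmap (face f c) = face f (cmap c) }.

Definition is_covering (X S : cube_complex) (p : cubical_map X S) : Prop :=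
  (forall s : vertex S, exists v : vertex X, p 0%N v = s) /\
  (forall n (v : vertex X) (c : cube S n), corner c = p 0%N v ->
     exists! d : cube X n, corner d = v /\ p n d = c).

Definition universal_covering (X S : cube_complex) (p : cubical_map X S) : Prop :=
  is_covering p /\ simply_connected X.

Record aut (X : cube_complex) := Aut {
  aut_fun :> forall n, cube X n -> cube X n;
  aut_inv : forall n, cube X n -> cube X n;
  aut_face : forall m n (f : cubemap m n) (c : cube X n),
    aut_fun (face f c) = face f (aut_fun c);
  aut_funK : forall n, cancel (@aut_fun n) (@aut_inv n);
  aut_invK : forall n, cancel (@aut_inv n) (@aut_fun n) }.

HB.instance Definition _ X := gen_eqMixin (aut X).
HB.instance Definition _ X := gen_choiceMixin (aut X).

Section AutGroup.
Variable X : cube_complex.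

Lemma autP (g h : aut X) : (forall n c, g n c = h n c) -> g = h.
Proof.
case: g h => [g g' gf gK g'K] [h h' hf hK h'K] /= gh.
have {}gh : g = h by apply: functional_extensionality_dep => n; apply/funext => c.
subst h; have gh' : g' = h'.
  apply: functional_extensionality_dep => n; apply/funext => c.
  by rewrite -{1}(h'K n c) gK.
by subst h'; congr Aut; exact: Prop_irrelevance.
Qed.

Definition aut_one : aut X.
Proof. by apply: (@Aut X (fun n c => c) (fun n c => c)). Defined.

Definition aut_mul (g h : aut X) : aut X.
Proof.
apply: (@Aut X (fun n c => g n (h n c)) (fun n c => aut_inv h (aut_inv g c))).
- by move=> m n f c; rewrite !aut_face.
- by move=> n c; rewrite !aut_funK.
- by move=> n c; rewrite !aut_invK.
Defined.

Definition aut_invg (g : aut X) : aut X.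
Proof.
apply: (@Aut X (@aut_inv X g) (@aut_fun X g)).
- by move=> m n f c; apply: (can_inj (@aut_funK X g m)); rewrite aut_face !aut_invK.
- exact: aut_invK.
- exact: aut_funK.
Defined.

Lemma aut_mulA : associative aut_mul.
Proof. by move=> f g h; apply: autP. Qed.
Lemma aut_mul1 : left_id aut_one aut_mul.
Proof. by move=> g; apply: autP. Qed.
Lemma aut_mulg1 : right_id aut_one aut_mul.
Proof. by move=> g; apply: autP. Qed.
Lemma aut_mulV : left_inverse aut_one aut_invg aut_mul.
Proof. by move=> g; apply: autP => n c /=; rewrite aut_funK. Qed.
Lemma aut_mulgV : right_inverse aut_one aut_invg aut_mul.
Proof. by move=> g; apply: autP => n c /=; rewrite aut_invK. Qed.

HB.instance Definition _ := isGroup.Build (aut X)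
  aut_mulA aut_mul1 aut_mulg1 aut_mulV aut_mulgV.

Definition stabilizer (v : vertex X) : set (aut X) := [set g : aut X | g 0%N v = v].

(* Independent of the representative of the point. *)
Definition aut_realization (R : realType) (g : aut X) (x : realization R X) :
    realization R X :=
  let: existT (existT n c) y := repr x in
  \pi_(realization R X)%qT (cell_point (g n c) y).

(* Aut(X) as a topological space, a subspace of the continuous self-maps of the
   realization with the compact-open topology. *)
Definition aut_compact_open (R : realType) : Type :=
  initial_topology (@aut_realization R : aut X ->
    {compact-open, realization R X -> realization R X}).
HB.instance Definition _ R := Topological.on (aut_compact_open R).

Definition aut_discrete (R : realType) : Prop :=
  forall A : set (aut_compact_open R), open A.

End AutGroup.

Definition deck_transformation (X S : cube_complex) (p : cubical_map X S)
    (g : aut X) : Prop :=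
  forall n (c : cube X n), p n (g n c) = p n c.

Definition finitely_generated (G : groupType) : Prop :=
  exists s : seq G, forall g : G, exists w : seq G,
    (forall x, x \in w -> x \in s \/ (x^-1)%g \in s) /\
    g = (\big[*%g/1%g]_(x <- w) x)%g.

Section Labeling.
Variables (X : cube_complex) (Sig0 : finType).

Definition span_square (e f : edge X) : Prop :=
  (exists! v, vertex_of e v /\ vertex_of f v) /\
  exists c : cube X 2, edge_of c e /\ edge_of c f.

Record admissible (inv : Sig0 -> Sig0) (l : edge X -> Sig0) : Prop := Admissible {
  adm_parallel : forall e f, parallel e f -> l e = l f;
  adm_rev : forall e, l (rev_edge e) = inv (l e);
  adm_inj : forall e f, start e = start f -> l e = l f -> e = f;
  adm_square : forall e1 e2 e1' e2',
    start e1 = start e2 -> start e1' = start e2' -> l e1 = l e1' -> l e2 = l e2' ->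
    (span_square e1 e2 <-> span_square e1' e2') }.

Variable l : edge X -> Sig0.

Definition labels_at (v : vertex X) : set Sig0 :=
  [set s | exists2 e, start e = v & l e = s].

Definition commute (s t : Sig0) : Prop :=
  exists e f, [/\ start e = start f, l e = s, l f = t & span_square e f].

Definition commute_sets (A B : {set Sig0}) : Prop :=
  forall s t, s \in A -> t \in B -> commute s t.

(* [c] is a cube in which [v] and [w] are opposite; up to reparametrizing it,
   they are its corners 0 and (1,...,1). *)
Definition diagonal_of n (c : cube X n) (v w : vertex X) : Prop :=
  [/\ (0 < n)%N, corner c = v & opposite_corner c = w].

Definition diagonal_label (v w : vertex X) (A : {set Sig0}) : Prop :=
  exists n (c : cube X n), diagonal_of c v w /\
    forall s, s \in A <-> exists e, [/\ edge_of c e, start e = v & l e = s].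

Definition diagonal_labels_at (v : vertex X) : set {set Sig0} :=
  [set A | exists w, diagonal_label v w A].

Definition diagonal_crosses (v w : vertex X) (h : edge X) : Prop :=
  exists n (c : cube X n), diagonal_of c v w /\
    exists2 e, edge_of c e & same_hyperplane h e.

(* [u] is the word of the cube path through the vertices v :: vs; the word
   determines [vs]. *)
Fixpoint spells (v : vertex X) (vs : seq (vertex X)) (u : seq {set Sig0}) : Prop :=
  match vs, u with
  | [::], [::] => True
  | w :: vs', A :: u' => diagonal_label v w A /\ spells w vs' u'
  | _, _ => False
  end.

Definition cube_language (o : vertex X) : set (seq {set Sig0}) :=
  [set u | exists vs, spells o vs u].

(* A single diagonal crosses each hyperplane at most once, hence only pairs of
   distinct diagonals matter. *)
Definition reduced_path (v : vertex X) (vs : seq (vertex X)) : Prop :=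
  forall i j h, (i < j < size vs)%N ->
    ~ (diagonal_crosses (nth v (v :: vs) i) (nth v vs i) h /\
       diagonal_crosses (nth v (v :: vs) j) (nth v vs j) h).

Definition reduced (o : vertex X) (u : seq {set Sig0}) : Prop :=
  cube_language o u /\ forall vs, spells o vs u -> reduced_path o vs.

Definition reducible (o : vertex X) (u : seq {set Sig0}) : Prop :=
  cube_language o u /\ ~ reduced o u.

(* Maps defined on [labels_at v] are represented by total maps, of which only
   the values on [labels_at v] are used. *)
Definition label_morphism (v : vertex X) (sigma : Sig0 -> Sig0) : Prop :=
  (forall s t, labels_at v s -> labels_at v t -> sigma s = sigma t -> s = t) /\
  (forall s t, labels_at v s -> labels_at v t ->
     (commute s t <-> commute (sigma s) (sigma t))).

Definition fixes_label (sigma : Sig0 -> Sig0) (A : {set Sig0}) : Prop :=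
  forall s, s \in A -> sigma s = s.

(* [v] is the endpoint of the path from [o] with word [u]. *)
Definition compatible (o : vertex X) (u : seq {set Sig0}) (v : vertex X)
    (sigma : Sig0 -> Sig0) : Prop :=
  forall A, diagonal_labels_at v A -> reducible o (rcons u A) ->
    fixes_label sigma A /\
    forall B, diagonal_labels_at v B -> commute_sets A B -> fixes_label sigma B.

Definition has_portrait (g : aut X) (v : vertex X) (sigma : Sig0 -> Sig0) : Prop :=
  forall w A, diagonal_label v w A ->
    diagonal_label (g 0%N v) (g 0%N w) (sigma @: A)%SET.

Definition appears (o v : vertex X) (sigma : Sig0 -> Sig0) : Prop :=
  exists g : aut X,
    [/\ stabilizer o g, has_portrait g v sigma &
        forall w, type1 o v w \/ type2 o v w -> g 0%N w = w].

End Labeling.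

(* Main.v *)
(* Aut(X)_o is a profinite group, hence finite or uncountable, so the labels
   matter only through the local finiteness of X that they imply.  Indeed, cubes
   of X are determined by their corner and axes, so an automorphism fixing o is
   determined by, and is a limit of, its restrictions to the finite balls around
   o.  If Aut(X)_o is infinite, each of these restrictions has a nontrivial
   kernel, and a diagonal argument shows that no sequence exhausts Aut(X)_o.
   If one vertex stabilizer is finite, all of them are, and as S has finitely
   many vertices and the deck group is transitive on fibres, Aut(X) acts
   properly and cofinitely on X, hence is finitely generated.  Discreteness is
   compared with finiteness of stabilizers through the open stars of vertices
   and edges: finitely many stars cover a compact set, and the automorphisms
   with a prescribed value at a vertex or an edge form an open set. *)
Require Import Defs.
From HB Require Import structures.
From mathcomp Require Import all_boot all_order all_algebra.
From mathcomp Require Import all_classical all_reals all_analysis.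
From mathcomp Require Import finmap lra.
Import numFieldNormedType.Exports.

Set Implicit Arguments.
Unset Strict Implicit.
Unset Printing Implicit Defensive.

Import Order.TTheory GRing.Theory Num.Theory.
Local Open Scope classical_set_scope.
Local Open Scope ring_scope.

(** * Edge paths and balls *)

Lemma cubemap_eq m n (f g : cubemap m n) :
  cm_base f = cm_base g -> cm_dir f = cm_dir g -> f = g.
Proof.
case: f g => [b d i] [b' d' i'] /= <- E.
by case: _ / E i' => i'; rewrite (bool_irrelevance i i').
Qed.

Lemma cm_dir_inj m n (f : cubemap m n) : injective (cm_dir f).
Proof. exact/injectiveP/cm_inj. Qed.

Lemma cubemap0_eq n (f g : cubemap 0 n) : cm_base f = cm_base g -> f = g.
Proof. by move=> h; apply: cubemap_eq => //; apply/ffunP => -[]. Qed.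

Lemma cm_vertex_dir m n (f : cubemap m n) x i :
  cm_vertex f x (cm_dir f i) = cm_base f (cm_dir f i) (+) x i.
Proof.
rewrite ffunE; congr (_ (+) _); apply/existsP/idP => [[j]|xi].
  by move=> /andP[/eqP /cm_dir_inj ->].
by exists i; rewrite eqxx.
Qed.

Lemma cm_vertex_nodir m n (f : cubemap m n) x j :
  (forall i, cm_dir f i != j) -> cm_vertex f x j = cm_base f j.
Proof.
move=> nj; rewrite ffunE; case: existsP => [[i]|_]; last by rewrite addbF.
by rewrite (negPf (nj i)).
Qed.

(** Every vertex of a cube is reached from the vertex 0 by edges that each switch on one coordinate.
    This carries a property that propagates along edges from the corner of a cube to all its
    vertices. *)
Lemma cube_vertex_ind n (P : {ffun 'I_n -> bool} -> Prop) :
  P [ffun => false] ->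
  (forall (x : {ffun 'I_n -> bool}) i,
    x i = false -> P x -> P [ffun j => (j == i) || x j]) ->
  forall x, P x.
Proof.
move=> P0 PS x; have [k le_k] := ubnP #|[pred i | x i]|.
elim: k => // k IHk in x le_k *.
have [[i xi]|nx] := pselect (exists i, x i); last first.
  suff -> : x = [ffun => false] by [].
  by apply/ffunP => i; rewrite ffunE; apply/negP => xi; apply: nx; exists i.
pose y : {ffun 'I_n -> bool} := [ffun j => (j != i) && x j].
have -> : x = [ffun j => (j == i) || y j].
  by apply/ffunP => j; rewrite !ffunE; case: eqVneq => // ->.
apply: PS; first by rewrite ffunE eqxx.
apply: IHk; rewrite -ltnS; apply: leq_trans le_k.
rewrite ltnS (cardD1 i [pred i | x i]) inE xi add1n ltnS.
by apply/subset_leq_card/fintype.subsetP => j; rewrite !inE !ffunE.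
Qed.

Section Cells.
Variable X : cube_complex.
Implicit Types (v w : vertex X) (e : edge X).

Lemma face_vtx m n (f : cubemap m n) (c : cube X n) x :
  face (cm_vtx x) (face f c) = face (cm_vtx (cm_vertex f x)) c.
Proof. by rewrite -face_comp; congr (face _ c); apply: cubemap0_eq. Qed.

Lemma face_vtx0 v x : face (cm_vtx x) v = v.
Proof.
rewrite -[RHS]face_id; congr (face _ v); apply: cubemap0_eq.
by apply/ffunP => -[].
Qed.

Lemma corner0 v : corner v = v.
Proof. exact: face_vtx0. Qed.

Lemma corner_face m n (f : cubemap m n) (c : cube X n) :
  corner (face f c) = face (cm_vtx (cm_base f)) c.
Proof.
rewrite /corner face_vtx; congr (face (cm_vtx _) c); apply/ffunP => j.
rewrite ffunE; case: existsP => [[i]|_]; last by rewrite addbF.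
by rewrite ffunE andbF.
Qed.

Lemma start_rev e : start (rev_edge e) = finish e.
Proof. exact: corner_face. Qed.

Lemma rev_edgeK e : rev_edge (rev_edge e) = e.
Proof.
rewrite /rev_edge -face_comp -[RHS]face_id; congr (face _ e).
apply: cubemap_eq; apply/ffunP => i; rewrite !ffunE ?ord1 //=.
by rewrite ?ffunE; case: existsP => // -[]; exists ord0; rewrite !ffunE.
Qed.

Lemma finish_rev e : finish (rev_edge e) = start e.
Proof. by rewrite -start_rev rev_edgeK. Qed.

Lemma edge_of_cube n (c : cube X n) (x : {ffun 'I_n -> bool}) i : x i = false ->
  start (face (cm_edge x i) c) = face (cm_vtx x) c /\
  finish (face (cm_edge x i) c) =
    face (cm_vtx [ffun j => (j == i) || x j]) c.
Proof.
move=> xi; split; first exact: corner_face.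
rewrite /finish /opposite_corner face_vtx; congr (face (cm_vtx _) c).
apply/ffunP => j; rewrite !ffunE; case: (eqVneq j i) => [->|ji] /=.
  by rewrite xi; apply/existsP; exists ord0; rewrite !ffunE eqxx.
case: existsP => [[k]|]; last by rewrite addbF.
by rewrite ffunE eq_sym (negPf ji).
Qed.

Lemma edge_path_cat v w s t :
  edge_path v (s ++ t) w <-> exists2 u, edge_path v s u & edge_path u t w.
Proof.
elim: s v => [|e s IHs] v /=; first by split=> [h|[u -> //]]; exists v.
split=> [[<- /IHs[u h1 h2]]|[u [<- h1] h2]]; first by exists u.
by split=> //; apply/IHs; exists u.
Qed.

Definition rev_path (s : seq (edge X)) : seq (edge X) :=
  rev (map (@rev_edge X) s).

Lemma edge_path_rev v w s : edge_path v s w -> edge_path w (rev_path s) v.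
Proof.
elim: s v => [|e s IHs] v //= [<- /IHs h].
rewrite /rev_path /= rev_cons -cats1; apply/edge_path_cat.
exists (finish e) => //=; split; first exact: start_rev.
exact: finish_rev.
Qed.

Fixpoint vball (v : vertex X) (r : nat) : set (vertex X) :=
  if r is r'.+1 then
    vball v r' `|` [set w | exists2 e, vball v r' (start e) & finish e = w]
  else [set v].

Lemma vball_center v r : vball v r v.
Proof. by elim: r => //= r IHr; left. Qed.

Lemma vball_le v r s : (r <= s)%N -> vball v r `<=` vball v s.
Proof.
move=> /subnKC <-; elim: (s - r)%N => [|k IHk]; first by rewrite addn0.
by rewrite addnS => w /IHk; left.
Qed.

Lemma vball_trans v w u r s : vball v r w -> vball w s u -> vball v (r + s) u.
Proof.
move=> vw; elim: s u => [|s IHs] u /=; first by move->; rewrite addn0.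
rewrite addnS => -[/IHs|[e /IHs ve <-]]; first by left.
by right; exists e.
Qed.

Lemma vball1 e : vball (start e) 1 (finish e).
Proof. by right; exists e. Qed.

Lemma vball_sym v w r : vball v r w -> vball w r v.
Proof.
elim: r w => [|r IHr] w /=; first by move->.
case=> [/IHr|[e /IHr ve <-]]; first by left.
apply: (@vball_trans _ _ _ 1 r _ ve).
by rewrite -finish_rev -start_rev; apply: vball1.
Qed.

Lemma vball_edge_path v w s : edge_path v s w -> vball v (size s) w.
Proof.
elim: s v => [|e s IHs] v //= [<- /IHs].
by apply: (@vball_trans _ _ _ 1); apply: vball1.
Qed.

Section Morphism.
Variables (Y : cube_complex) (g : forall n, cube X n -> cube Y n).
Hypothesis g_face : forall m n (f : cubemap m n) (c : cube X n),
  g (face f c) = face f (g c).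

Lemma corner_morph n (c : cube X n) : g (corner c) = corner (g c).
Proof. exact: g_face. Qed.
Lemma start_morph e : g (start e) = start (g e).
Proof. exact: g_face. Qed.
Lemma finish_morph e : g (finish e) = finish (g e).
Proof. exact: g_face. Qed.
Lemma axis_morph n (c : cube X n) i : g (axis c i) = axis (g c) i.
Proof. exact: g_face. Qed.
Lemma rev_edge_morph e : g (rev_edge e) = rev_edge (g e).
Proof. exact: g_face. Qed.

End Morphism.

Lemma vball_aut (g : aut X) v r w : vball v r w -> vball (g 0 v) r (g 0 w).
Proof.
elim: r w => [|r IHr] w /=; first by move->.
case=> [/IHr|[e /IHr ve <-]]; first by left.
right; exists (g 1 e); last by rewrite -(finish_morph (@aut_face X g)).
by rewrite -(start_morph (@aut_face X g)).
Qed.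

End Cells.

(** * Automorphisms of locally finite complexes *)

Lemma finite_set_subsingleton T (A : set T) :
  (forall x y, A x -> A y -> x = y) -> finite_set A.
Proof.
move=> A1; have [[x Ax]|nA] := pselect (exists x, A x).
  by apply: (@sub_finite_set _ _ [set x]) => // y Ay; apply: A1.
by rewrite (_ : A = set0) // -subset0 => x Ax; apply: nA; exists x.
Qed.

(** Induction on [D]: evaluation at one point of [D] splits [A] into finitely many fibres, and on
    each fibre the remaining points still separate. *)
Lemma finite_set_separated T U V (ev : T -> U -> V) (A : set T) (D : set U)
    (E : set V) : finite_set D -> finite_set E ->
  (forall x d, A x -> D d -> E (ev x d)) ->
  (forall x y, A x -> A y -> (forall d, D d -> ev x d = ev y d) -> x = y) ->
  finite_set A.
Proof.
move=> /(@finite_seqP {classic U})[s ->] finE.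
elim: s A => [|d s IHs] A AE Asep.
  by apply: finite_set_subsingleton => x y Ax Ay; apply: Asep.
apply: (@sub_finite_set _ _ (\bigcup_(e in E) (A `&` [set x | ev x d = e]))).
  by move=> x Ax; exists (ev x d) => //; apply: AE => //; rewrite /= mem_head.
apply: bigcup_finite => // e _; apply: IHs => [x d' [Ax _] sd'|].
  by apply: AE => //=; rewrite inE [_ \in s]sd' orbT.
move=> x y [Ax xd] [Ay yd] xy; apply: Asep => // d'.
by rewrite /= inE => /orP[/eqP->|/xy //]; rewrite xd yd.
Qed.

Section AutTheory.
Variable X : cube_complex.
Implicit Types (v w o : vertex X) (g h : aut X).

Lemma autM g h n (c : cube X n) : (g * h)%g n c = g n (h n c).
Proof. by []. Qed.
Lemma autK g n (c : cube X n) : (g^-1)%g n (g n c) = c.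
Proof. exact: aut_funK. Qed.
Lemma autVK g n (c : cube X n) : g n ((g^-1)%g n c) = c.
Proof. exact: aut_invK. Qed.

Lemma stabM o g h :
  stabilizer o g -> stabilizer o h -> stabilizer o (g * h)%g.
Proof. by move=> go ho; rewrite /stabilizer /mkset autM ho. Qed.
Lemma stabV o g : stabilizer o g -> stabilizer o (g^-1)%g.
Proof. by move=> go; rewrite /stabilizer /mkset -{1}go autK. Qed.

(** Cubes of every dimension are tested. Since any vertex of a cube becomes its corner after
    reparametrization, this is agreement on all cubes that touch [F]. *)
Definition agree_on (F : set (vertex X)) g h : Prop :=
  forall n (c : cube X n), F (corner c) -> g n c = h n c.

Lemma agree_sym F g h : agree_on F g h -> agree_on F h g.
Proof. by move=> gh n c /gh. Qed.

Lemma agree_trans F g h (k : aut X) :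
  agree_on F g h -> agree_on F h k -> agree_on F g k.
Proof. by move=> gh hk n c Fc; rewrite gh ?hk. Qed.

Lemma agree_sub F F' g h : F `<=` F' -> agree_on F' g h -> agree_on F g h.
Proof. by move=> FF' gh n c /FF' /gh. Qed.

Lemma stab_vball o g r v : stabilizer o g -> vball o r (g 0 v) <-> vball o r v.
Proof.
move=> go; split=> [/(vball_aut (g^-1)%g)|/(vball_aut g)]; last by rewrite go.
by rewrite autK -{1}go autK.
Qed.

Lemma agree_inv o r g h : stabilizer o g -> agree_on (vball o r) g h ->
  agree_on (vball o r) (g^-1)%g (h^-1)%g.
Proof.
move=> go gh n c oc.
rewrite -[c in RHS](autVK g) gh ?autK // -(corner_morph (@aut_face X _)).
by apply/(stab_vball r _ go); rewrite autVK.
Qed.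

Lemma finite_coset o w :
  finite_set (stabilizer o) -> finite_set [set g : aut X | g 0 o = w].
Proof.
move=> fin.
have [[g go]|nog] := pselect (exists g : aut X, g 0 o = w); last first.
  by apply: finite_set_subsingleton => g h /= go; case: nog; exists g.
apply: (@sub_finite_set _ _ ((fun h => (g * h)%g) @` stabilizer o)).
  move=> h /= ho; exists (g^-1 * h)%g; last by rewrite mulgA mulgV mul1g.
  by rewrite /stabilizer /mkset autM ho -go autK.
exact: finite_image.
Qed.

Lemma finite_transporter o (F : set (vertex X)) :
  finite_set (stabilizer o) -> finite_set F ->
  finite_set [set g : aut X | F (g 0 o)].
Proof.
move=> fo fF.
apply: (@sub_finite_set _ _ (\bigcup_(w in F) [set g : aut X | g 0 o = w])).
  by move=> g Fg; exists (g 0 o).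
by apply: bigcup_finite => // w _; apply: finite_coset.
Qed.

(** * Determination by finite balls, limits, and uncountability of infinite stabilizers *)

Hypothesis cube_eq : forall n (c d : cube X n),
  corner c = corner d -> axis c =1 axis d -> c = d.
Hypothesis locally_finite : forall v, finite_set [set e : edge X | start e = v].
Hypothesis path_connected : forall v w, exists s, edge_path v s w.

Lemma vball_exists v w : exists r, vball v r w.
Proof.
by have [s /vball_edge_path] := path_connected v w; exists (size s).
Qed.

Lemma finite_sub_vball o (F : set (vertex X)) :
  finite_set F -> exists r, F `<=` vball o r.
Proof.
move=> /(@finite_seqP {classic (vertex X)})[s ->].
elim: s => [|v s [r sr]]; first by exists 0%N.
have [r' ov] := vball_exists o v.
exists (maxn r' r) => w /=; rewrite inE => /orP[/eqP->|/sr].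
  by apply: vball_le ov; apply: leq_maxl.
by apply: vball_le; apply: leq_maxr.
Qed.

Lemma finite_edges (F : set (vertex X)) :
  finite_set F -> finite_set [set e : edge X | F (start e)].
Proof.
move=> fF.
apply: (@sub_finite_set _ _ (\bigcup_(w in F) [set e : edge X | start e = w])).
  by move=> e Fe; exists (start e).
exact: bigcup_finite.
Qed.

Lemma finite_vball v r : finite_set (vball v r).
Proof.
elim: r => [|r IHr] /=; first exact: finite_set1.
rewrite finite_setU; split => //.
by apply: finite_image; apply: finite_edges.
Qed.

(** Agreement on vertices spreads outwards along the edges, and a cube is determined by its corner
    and axes. *)
Lemma agree_on_vball o r g h : g 0 o = h 0 o ->
  (forall e, vball o r (start e) -> g 1 e = h 1 e) -> agree_on (vball o r) g h.
Proof.
move=> gho gh.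
have ghv : forall v, vball o r v -> g 0 v = h 0 v.
  suff: forall s v, (s <= r)%N -> vball o s v -> g 0 v = h 0 v.
    by move=> + v; apply.
  elim=> [|s IHs] v sr /=; first by move->.
  have {}IHs := IHs _ (ltnW sr); case=> [/IHs //|[e se <-]].
  rewrite !(finish_morph (@aut_face X _)) gh //.
  exact: vball_le (ltnW sr) _ se.
move=> n c oc; apply: cube_eq => [|i].
  by rewrite -!(corner_morph (@aut_face X _)) ghv.
rewrite -!(axis_morph (@aut_face X _)) gh //.
by rewrite /start corner_face.
Qed.

Lemma aut_eq o g h : (forall r, agree_on (vball o r) g h) -> g = h.
Proof.
move=> gh; apply: autP => n c.
by have [r] := vball_exists o (corner c); apply: gh.
Qed.

Lemma aut_neq o g h : g <> h -> exists r, ~ agree_on (vball o r) g h.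
Proof.
by move=> gh; apply/existsNP => H; apply: gh; apply: aut_eq H.
Qed.

(** An element of [A] sends the finitely many edges starting in the ball around [o] to edges
    starting in a ball of the same radius around a point of [F]. Only finitely many such
    restrictions exist, and each determines the element. *)
Lemma finite_of_agree o r (F : set (vertex X)) (A : set (aut X)) :
  finite_set F -> (forall g, A g -> F (g 0 o)) ->
  (forall g h, A g -> A h -> agree_on (vball o r) g h -> g = h) -> finite_set A.
Proof.
move=> fF AF Asep.
apply: (@sub_finite_set _ _ (\bigcup_(w in F)
  (A `&` [set g : aut X | g 0 o = w]))).
  by move=> g Ag; exists (g 0 o); [apply: AF|].
apply: bigcup_finite => // w _.
apply: (@finite_set_separated _ _ _ (fun (g : aut X) e => g 1 e) _
  [set e | vball o r (start e)] [set e | vball w r (start e)]).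
- exact/finite_edges/finite_vball.
- exact/finite_edges/finite_vball.
- move=> g e [_ /= <-] oe; rewrite -(start_morph (@aut_face X _)).
  exact: vball_aut.
- move=> g h [Ag go] [Ah ho] gh; apply: Asep => //; apply: agree_on_vball => //.
  by rewrite go ho.
Qed.

(** An element fixing [v] keeps [o] in a fixed finite ball around [v], so the stabilizer of [v] lies
    in finitely many cosets of that of [o]. *)
Lemma finite_stabilizer o v :
  finite_set (stabilizer o) -> finite_set (stabilizer v).
Proof.
move=> fo; have [r vo] := vball_exists v o.
apply: sub_finite_set (finite_transporter fo (finite_vball v r)) => g /= gv.
by rewrite -gv; apply: vball_aut.
Qed.

(** Otherwise the elements of the stabilizer would be determined by their restrictions to one finite
    ball, and it would be finite. *)
Lemma stab_agree1 o r : infinite_set (stabilizer o) ->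
  exists k, [/\ stabilizer o k, agree_on (vball o r) k 1%g & k <> 1%g].
Proof.
move=> inf; apply: contrapT => nk; apply: inf.
apply: (@finite_of_agree o r [set o]) => // g h go ho gh.
apply: contrapT => ngh; apply: nk; exists (g^-1 * h)%g; split.
- exact: stabM (stabV go) ho.
- by move=> n c oc; rewrite autM -gh // autK.
- by move=> gh1; apply: ngh; rewrite -[h]mul1g -(mulgV g) -mulgA gh1 mulg1.
Qed.

(** On each cube the sequence is eventually constant. So are the inverses, because elements of the
    stabilizer preserve the balls around [o]; hence the pointwise limit is invertible. *)
Lemma aut_limit o (hs : nat -> aut X) (r : nat -> nat) :
  (forall k, stabilizer o (hs k)) -> (forall k, (r k < r k.+1)%N) ->
  (forall k, agree_on (vball o (r k)) (hs k) (hs k.+1)) ->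
  exists2 h, stabilizer o h & forall k, agree_on (vball o (r k)) h (hs k).
Proof.
move=> hso rS hsS.
have r_le k m : (k <= m)%N -> (r k <= r m)%N.
  move=> /subnKC <-; elim: (m - k)%N => [|d IHd]; first by rewrite addn0.
  by rewrite addnS (leq_trans IHd) // ltnW.
have k_le k : (k <= r k)%N by elim: k => // k IHk; apply: leq_ltn_trans IHk _.
have hsm k m : (k <= m)%N -> agree_on (vball o (r k)) (hs k) (hs m).
  move=> /subnKC <-; elim: (m - k)%N => [|d IHd]; first by rewrite addn0.
  rewrite addnS; apply: agree_trans IHd _.
  by apply: agree_sub (hsS _); apply: vball_le; apply: r_le; apply: leq_addr.
(* From stage [N v] on, the values at cubes with corner [v] no longer change; the limit at [c] is
   read off at stage [N (corner c)]. *)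
have /choice[N oN] v : exists k, vball o (r k) v.
  by have [k ok] := vball_exists o v; exists k; apply: vball_le ok.
have lim (hs' : nat -> aut X) :
    (forall k m, (k <= m)%N -> agree_on (vball o (r k)) (hs' k) (hs' m)) ->
    forall k n (c : cube X n), vball o (r k) (corner c) ->
    hs' (N (corner c)) n c = hs' k n c.
  move=> hs'm k n c oc; have [Nk|/ltnW kN] := leqP (N (corner c)) k.
    exact: hs'm.
  by rewrite -(hs'm _ _ kN).
have hsE := lim _ hsm.
have hsVE := lim (fun k => (hs k)^-1%g) (fun k m km =>
  agree_inv (hso k) (hsm k m km)).
have fun_face m n (f : cubemap m n) (c : cube X n) :
    hs (N (corner (face f c))) m (face f c) = face f (hs (N (corner c)) n c).
  (* A cube and its face may have different corners, so both values are compared at a common later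
     stage. *)
  pose k := maxn (N (corner c)) (N (corner (face f c))).
  have oc : vball o (r k) (corner c).
    by apply: vball_le (oN _); apply/r_le/leq_maxl.
  have ofc : vball o (r k) (corner (face f c)).
    by apply: vball_le (oN _); apply/r_le/leq_maxr.
  by rewrite (hsE k) // (hsE k) // aut_face.
have stab_corner g n (c : cube X n) k : stabilizer o g ->
    vball o (r k) (corner c) -> vball o (r k) (corner (g n c)).
  by move=> go oc; rewrite -(corner_morph (@aut_face X _)); apply/stab_vball.
have hsVo k : stabilizer o (hs k)^-1%g by exact: stabV.
pose h := @Aut X (fun n c => hs (N (corner c)) n c)
  (fun n c => (hs (N (corner c)))^-1%g n c) fun_face.
have hK n : cancel (fun c : cube X n => hs (N (corner c)) n c)
                   (fun c => (hs (N (corner c)))^-1%g n c).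
  by move=> c; rewrite (hsVE (N (corner c))) ?autK //; apply: stab_corner.
have hVK n : cancel (fun c : cube X n => (hs (N (corner c)))^-1%g n c)
                    (fun c => hs (N (corner c)) n c).
  by move=> c; rewrite (hsE (N (corner c))) ?autVK //; apply: stab_corner.
by exists (h hK hVK) => [|k n c]; [apply: hso|apply: hsE].
Qed.

(** Diagonal argument: against an enumeration [f], build pairs of an automorphism and a radius,
    where the next automorphism agrees with the current one on the current ball and differs from
    [f k] on the next ball. The limit escapes [f]. *)
Lemma stabilizer_uncountable o :
  infinite_set (stabilizer o) -> ~ countable (stabilizer o).
Proof.
move=> inf /pfcard_geP[so0|[f]].
  by have : set0 (1%g : aut X) by rewrite -so0.
have step k (hr : aut X * nat) : exists hr' : aut X * nat,
    stabilizer o hr.1 -> [/\ stabilizer o hr'.1, (hr.2 < hr'.2)%N,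
      agree_on (vball o hr.2) hr.1 hr'.1 &
      ~ agree_on (vball o hr'.2) hr'.1 (f k)].
  (* The recursion runs over all pairs, so a pair outside the stabilizer gets itself as a dummy
     successor. *)
  case: hr => h r /=; have [ho|nho] := pselect (stabilizer o h); last first.
    by exists (h, r).
  have [h' [ho' hh' nh']] : exists h',
      [/\ stabilizer o h', agree_on (vball o r) h h' & h' <> f k].
    have [u [uo u1 uN1]] := stab_agree1 r inf.
    have [hf|hf] := pselect (h = f k); last by exists h.
    (* Only if [h] equals [f k] must it be changed; multiplying by [u], trivial on the ball but not
       globally, leaves the values on the ball intact. *)
    exists (h * u)%g; split.
    - exact: stabM.
    - by move=> n c oc; rewrite autM u1.
    - by rewrite -hf -[RHS]mulg1 => /mulgI.
  have [r' nr'] := aut_neq o nh'.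
  exists (h', maxn r.+1 r'); split=> //=; first exact: leq_maxl.
  by move=> agr; apply/nr'/(agree_sub _ agr)/vball_le/leq_maxr.
have /choice[F FP] : forall khr : nat * (aut X * nat), exists hr', _ :=
  fun khr => step khr.1 khr.2.
pose st := fix st k := if k is k'.+1 then F (k', st k') else (1%g, 0%N).
have sto k : stabilizer o (st k).1.
  by elim: k => //= k IHk; have [] := FP (k, st k) IHk.
have [h ho hst] := @aut_limit o (fun k => (st k).1) (fun k => (st k).2) sto
  (fun k => let: And4 _ lt _ _ := FP (k, st k) (sto k) in lt)
  (fun k => let: And4 _ _ agr _ := FP (k, st k) (sto k) in agr).
(* The limit is some [f k], yet it agrees with stage [k.+1] on the ball where that stage was made to
   differ from [f k]. *)
have [k _ fk] := 'surj_f ho.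
have [_ _ _] := FP (k, st k) (sto k); rewrite /= fk; apply.
exact/agree_sym/(hst k.+1).
Qed.

End AutTheory.

(** * Finite generation *)

Section CofiniteAction.
Variable X : cube_complex.
Hypothesis locally_finite :
  forall v : vertex X, finite_set [set e : edge X | start e = v].
Hypothesis path_connected :
  forall v w : vertex X, exists s, edge_path v s w.

(* Milnor-Svarc: an edge path from [o] to [g o] is shadowed by a sequence of
   translates of [o], and consecutive translates differ by one of the finitely
   many elements that move [o] by at most 2D+1. *)
Lemma finitely_generated_cofinite (o : vertex X) (K : set (vertex X)) :
  finite_set (stabilizer o) -> finite_set K ->
  (forall v, exists g : aut X, K (g 0 v)) -> finitely_generated (aut X).
Proof.
move=> fo fK coK.
have [D KD] := finite_sub_vball path_connected o fK.
(* All of [K] lies within [D] of [o], so the translates of [o] are [D]-dense. *)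
have near_o v : exists h : aut X, vball v D (h 0 o).
  have [h /KD oh] := coK v; exists h^-1%g.
  by have /(vball_aut (h^-1)%g) := vball_sym oh; rewrite autK.
have : finite_set [set g : aut X | vball o (D + (1 + D)) (g 0 o)].
  by apply: finite_transporter => //; apply: finite_vball.
move=> /finite_seqP[s sE]; exists s.
have sP (g : aut X) : vball o (D + (1 + D)) (g 0 o) -> g \in s.
  by move=> og; have : [set` s] g by rewrite -sE.
pose gen (g : aut X) := exists w : seq (aut X),
  (forall x, x \in w -> x \in s \/ (x^-1)%g \in s) /\
  g = (\big[*%g/1%g]_(x <- w) x)%g.
have genM g h : gen g -> h \in s -> gen (g * h)%g.
  move=> [w [ws ->]] hs; exists (rcons w h); split.
    by move=> x; rewrite mem_rcons inE => /predU1P[->|/ws //]; left.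
  by rewrite -cats1 big_cat big_seq1.
suff shadow t v (g : aut X) : edge_path o t v -> vball v D (g 0 o) -> gen g.
  move=> g; have [t ot] := path_connected o (g 0 o).
  exact: shadow ot (vball_center _ _).
elim/last_ind: t v g => [|t e IHt] v g /=.
  move=> <- og; rewrite -[g]mul1g; apply: genM.
    by exists [::]; split=> //; rewrite big_nil.
  by apply: sP; apply: vball_le og; apply: leq_addr.
rewrite -cats1 => /edge_path_cat[u ou [/= eu ev]] vg.
(* With [h o] near the penultimate vertex [u], the new letter is the inverse of [h] times [g]; the
   distance from [h o] to [g o] is at most [D] to reach [u], one edge, and [D] again. *)
have [h uh] := near_o u.
rewrite -[g]mul1g -(mulgV h) -mulgA; apply: genM (IHt _ h ou uh) _.
apply: sP; rewrite autM.
suff /(vball_aut (h^-1)%g) : vball (h 0 o) (D + (1 + D)) (g 0 o).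
  by rewrite autK.
apply: vball_trans (vball_sym uh) _; apply: vball_trans _ vg.
by rewrite -ev -eu; apply: vball1.
Qed.

End CofiniteAction.

(** * Path lifting and deck transformations *)

Section Covering.
Variables (X S : cube_complex) (p : cubical_map X S).
Hypothesis p_covering : is_covering p.
Implicit Types (v w x y : vertex X) (s t : seq (edge X)).

Lemma lift_exists n v (c : cube S n) :
  corner c = p 0%N v -> exists2 d : cube X n, corner d = v & p n d = c.
Proof. by move=> /(p_covering.2)[d [[dv dc] _]]; exists d. Qed.

Lemma lift_unique n (c d : cube X n) :
  corner c = corner d -> p n c = p n d -> c = d.
Proof.
move=> cd pcd; have [|e [_ eU]] := p_covering.2 n (corner c) (p n c).
  by rewrite (corner_morph (@cmap_face _ _ p)).
by rewrite -(eU c) // (eU d).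
Qed.

(** By unique lifting it suffices to compare images, where the link condition of [S] applies. *)
Lemma covering_cube_eq : nonpositively_curved S -> forall n (c d : cube X n),
  corner c = corner d -> axis c =1 axis d -> c = d.
Proof.
move=> [_ S_eq _] n c d cd acd; apply: lift_unique => //; apply: S_eq.
  by rewrite -!(corner_morph (@cmap_face _ _ p)) cd.
by move=> i; rewrite -!(axis_morph (@cmap_face _ _ p)) acd.
Qed.

(* [y] is the end of the lift, starting at [w], of the image of the path [s]. *)
Fixpoint lift_ends w s y : Prop :=
  if s is e :: s' then
    exists f, [/\ start f = w, p 1%N f = p 1%N e & lift_ends (finish f) s' y]
  else w = y.

Lemma lift_ends_cat w s s' y :
  lift_ends w (s ++ s') y <-> exists2 z, lift_ends w s z & lift_ends z s' y.
Proof.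
elim: s w => [|e s IHs] w /=; first by split=> [h|[z ->]]; first by exists w.
split=> [[f [fw fe /IHs[z sz zy]]]|[z [f [fw fe sz]] zy]].
  by exists z => //; exists f.
by exists f; split=> //; apply/IHs; exists z.
Qed.

Lemma lift_ends_unique w s y y' :
  lift_ends w s y -> lift_ends w s y' -> y = y'.
Proof.
elim: s w => [|e s IHs] w /=; first by move=> -> ->.
move=> [f [fw fe fy]] [f' [fw' fe' fy']]; apply: IHs fy _.
by rewrite (@lift_unique 1 f f') //; [rewrite -fw in fw'|rewrite fe].
Qed.

Lemma lift_ends_exists v w s x : edge_path v s x -> p 0%N w = p 0%N v ->
  exists y, lift_ends w s y.
Proof.
elim: s v w => [|e s IHs] v w /=; first by exists w.
move=> [ev ex] pwv; have [|f fw fe] := @lift_exists 1 w (p 1%N e).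
  by rewrite -(corner_morph (@cmap_face _ _ p)) pwv -ev.
have [|y fy] := IHs _ (finish f) ex; last by exists y, f.
by rewrite !(finish_morph (@cmap_face _ _ p)) fe.
Qed.

Lemma lift_ends_sym v w s x y : edge_path v s x -> lift_ends w s y ->
  exists2 t, edge_path w t y & lift_ends v t x.
Proof.
elim: s v w => [|e s IHs] v w /=; first by move=> -> <-; exists [::].
move=> [ev ex] [f [fw fe /(IHs _ _ ex)[t ft ty]]].
by exists (f :: t); last by exists e.
Qed.

Lemma lift_ends_proj v w s x y : p 0%N v = p 0%N w ->
  edge_path v s x -> lift_ends w s y -> p 0%N x = p 0%N y.
Proof.
elim: s v w => [|e s IHs] v w /= pvw; first by move=> <- <-.
move=> [ev ex] [f [fw fe]]; apply: IHs ex.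
by rewrite !(finish_morph (@cmap_face _ _ p)) fe.
Qed.

Lemma lift_ends_rev w s y : lift_ends w (rev_path s) y -> lift_ends y s w.
Proof.
elim: s y => [|e s IHs] y /=; first by move->.
rewrite /rev_path /= rev_cons -cats1.
move=> /lift_ends_cat[z /IHs zw [f [fz fe fy]]].
exists (rev_edge f); rewrite start_rev finish_rev fz; split=> //.
by rewrite (rev_edge_morph (@cmap_face _ _ p)) fe
  -(rev_edge_morph (@cmap_face _ _ p)) rev_edgeK.
Qed.

(** By unique lifting, a backtrack lifts to a backtrack, and a path along two sides of a square
    lifts to a path along two sides of the lifted square. *)
Lemma lift_ends_step v w s s' y : p 0%N w = p 0%N v -> homotopy_step v s s' ->
  lift_ends w s y -> lift_ends w s' y.
Proof.
move=> pwv; case=> {s s'} [s t e|s t c] x _ vx /lift_ends_cat[z sz].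
  move=> /= [f [fz fe [f' [ff' fe' ty]]]]; apply/lift_ends_cat; exists z => //.
  have f'E : f' = rev_edge f.
    apply: lift_unique; first by rewrite [LHS]ff' -start_rev.
    by rewrite fe' !(rev_edge_morph (@cmap_face _ _ p)) fe.
  by rewrite f'E finish_rev fz in ty.
move=> /= [f [fz fe [f' [ff' fe' ty]]]]; apply/lift_ends_cat; exists z => //.
have [|d dz dc] := @lift_exists 2 z (p 2%N c).
  rewrite -fz (start_morph (@cmap_face _ _ p)) fe.
  by rewrite -(start_morph (@cmap_face _ _ p)) [start _]corner_face
    (corner_morph (@cmap_face _ _ p)).
have fE : f = sq_bottom d.
  apply: lift_unique; first by rewrite [LHS]fz -dz [RHS]corner_face.
  by rewrite fe /sq_bottom !(axis_morph (@cmap_face _ _ p)) dc.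
have f'E : f' = sq_right d.
  apply: lift_unique.
    rewrite [LHS]ff' fE [RHS]corner_face /sq_bottom /axis.
    have [//|_ ->] := edge_of_cube d (x := [ffun => false]) (i := ord0).
      by rewrite ffunE.
    by congr (face (cm_vtx _) d); apply/ffunP => j; rewrite !ffunE orbF.
  by rewrite fe' /sq_right !(@cmap_face _ _ p) dc.
have [] := @edge_of_cube X 2 d [ffun => false] ord_max; first by rewrite ffunE.
have [] := @edge_of_cube X 2 d [ffun j => j == ord_max] ord0.
  by rewrite ffunE.
have [] := @edge_of_cube X 2 d [ffun j => j == ord0] ord_max.
  by rewrite ffunE.
rewrite -/(sq_top d) -/(sq_right d) -/(axis d ord_max) -/(sq_left d).
move=> sr fr st ft sl fl.
exists (sq_left d); split; first by rewrite sl -dz.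
  by rewrite /sq_left !(axis_morph (@cmap_face _ _ p)) dc.
exists (sq_top d); split.
- rewrite st fl; congr (face (cm_vtx _) d).
  by apply/ffunP => j; rewrite !ffunE orbF.
- by rewrite /sq_top !(@cmap_face _ _ p) dc.
- suff -> : finish (sq_top d) = finish (sq_right d) by rewrite -f'E.
  rewrite ft fr; congr (face (cm_vtx _) d).
  by apply/ffunP => j; rewrite !ffunE orbC.
Qed.

Lemma homotopy_step_path v s s' : homotopy_step v s s' ->
  exists x, edge_path v s x.
Proof. by case=> [? ? ? x h _|? ? ? x h _]; exists x. Qed.

Lemma lift_ends_homotopic v w s s' y : p 0%N w = p 0%N v ->
  homotopic v s s' -> lift_ends w s y <-> lift_ends w s' y.
Proof.
move=> pwv; elim=> {s s'} [s s' ss'|//|s s' _ IH|s s' s'' _ -> _ //].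
  split=> [|s'y]; first exact: lift_ends_step ss'.
  (* Steps are directed; the converse follows because the lift of [s] exists and, by the direct
     implication and uniqueness, ends at the same vertex as that of [s']. *)
  have [x vx] := homotopy_step_path ss'.
  have [y' sy'] := lift_ends_exists vx pwv.
  have := lift_ends_step pwv ss' sy'.
  by move=> /(lift_ends_unique s'y) ->.
by rewrite IH.
Qed.

(** * Deck transformations of a simply connected covering *)

Hypothesis X_simply_connected : simply_connected X.

(** The loop [s] followed by the reverse of [s'] is null-homotopic, so its lift at [w] closes up. *)
Lemma lift_ends_well_defined v w s s' x y y' : p 0%N w = p 0%N v ->
  edge_path v s x -> edge_path v s' x -> lift_ends w s y ->
  lift_ends w s' y' -> y = y'.
Proof.
move=> pwv sx s'x sy s'y.
have loop : edge_path v (s ++ rev_path s') v.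
  by apply/edge_path_cat; exists x => //; apply: edge_path_rev.
have [_] := lift_ends_homotopic w pwv (X_simply_connected.2 _ _ loop).
move=> /(_ erefl)/lift_ends_cat[z sz /lift_ends_rev s'z].
by rewrite (lift_ends_unique sy sz) (lift_ends_unique s'y s'z).
Qed.

(** For [v] and [w] in one fibre, this is the graph on vertices of the deck transformation carrying
    [v] to [w]. *)
Definition lifts_to v w x y : Prop :=
  exists2 s, edge_path v s x & lift_ends w s y.

Definition cube_lifts_to v w n (c d : cube X n) : Prop :=
  lifts_to v w (corner c) (corner d) /\ p n d = p n c.

Lemma lifts_to_edge v w (e f : edge X) :
  lifts_to v w (start e) (start f) -> p 1%N f = p 1%N e ->
  lifts_to v w (finish e) (finish f).
Proof.
move=> [s vs ws] fe; exists (s ++ [:: e]).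
  by apply/edge_path_cat; exists (start e).
by apply/lift_ends_cat; exists (start f) => //=; exists f.
Qed.

Section Fibre.
Variables v w : vertex X.
Hypothesis pvw : p 0%N v = p 0%N w.

(** The corner of the face is joined to the corner of the cube by edges of the cube, and the
    relation passes along corresponding edges of [c] and [d]. *)
Lemma cube_lifts_to_face m n (f : cubemap m n) (c d : cube X n) :
  cube_lifts_to v w c d -> cube_lifts_to v w (face f c) (face f d).
Proof.
move=> [cd pcd]; split; last by rewrite !cmap_face pcd.
rewrite !corner_face; elim/cube_vertex_ind: (cm_base f) => // x i xi.
have [<- <-] := edge_of_cube c xi; have [<- <-] := edge_of_cube d xi.
by move=> /lifts_to_edge; apply; rewrite !cmap_face pcd.
Qed.

Lemma cube_lifts_to_exists n (c : cube X n) :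
  exists d, cube_lifts_to v w c d.
Proof.
have [s vs] := X_simply_connected.1 v (corner c).
have [y wy] := lift_ends_exists vs (esym pvw).
have [|d dy dc] := @lift_exists n y (p n c).
  by rewrite -(lift_ends_proj pvw vs wy) -(corner_morph (@cmap_face _ _ p)).
by exists d; split=> //; exists s; rewrite // dy.
Qed.

Lemma cube_lifts_to_unique n (c d d' : cube X n) :
  cube_lifts_to v w c d -> cube_lifts_to v w c d' -> d = d'.
Proof.
move=> [[s vs ws] dc] [[s' vs' ws'] dc']; apply: lift_unique.
  exact: lift_ends_well_defined (esym pvw) vs vs' ws ws'.
by rewrite dc.
Qed.

End Fibre.

Lemma cube_lifts_to_sym v w n (c d : cube X n) :
  cube_lifts_to v w c d -> cube_lifts_to w v d c.
Proof.
by move=> [[s vs /(lift_ends_sym vs)[t wt vt]] dc]; split=> //; exists t.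
Qed.

Lemma fibre_transitive v w : p 0%N v = p 0%N w ->
  exists g : aut X, g 0%N v = w.
Proof.
move=> pvw; have ex := @cube_lifts_to_exists v w pvw.
have exV := @cube_lifts_to_exists w v (esym pvw).
(* The inverse comes from the same construction with [v] and [w] exchanged, since the graph relation
   is symmetric. *)
pose g n c := projT1 (cid (@ex n c)); pose gV n c := projT1 (cid (@exV n c)).
have gP n c : cube_lifts_to v w c (g n c) := projT2 (cid (@ex n c)).
have gVP n c : cube_lifts_to w v c (gV n c) := projT2 (cid (@exV n c)).
have g_face m n (f : cubemap m n) (c : cube X n) :
    g m (face f c) = face f (g n c).
  by apply: (cube_lifts_to_unique pvw (gP _ _)); apply: cube_lifts_to_face.
have gK n : cancel (g n) (gV n).
  move=> c; apply: (cube_lifts_to_unique (esym pvw) (gVP _ _)).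
  exact: cube_lifts_to_sym.
have gVK n : cancel (gV n) (g n).
  move=> c; apply: (cube_lifts_to_unique pvw (gP _ _)).
  exact: cube_lifts_to_sym.
exists (Aut g_face gK gVK); apply: (cube_lifts_to_unique pvw (gP _ _)).
by split=> //; exists [::]; rewrite /= corner0.
Qed.

End Covering.

(** * Open stars and the compact-open topology *)

Section CubePoints.
Variable R : realType.

(* This is |y_j - b_j| for [y] in the unit cube. *)
Definition offset n (b : {ffun 'I_n -> bool}) (y : 'rV[R]_n) (j : 'I_n) : R :=
  if b j then 1 - y 0 j else y 0 j.

Lemma cm_point_dir m n (f : cubemap m n) (x : 'rV[R]_m) i :
  cm_point f x 0 (cm_dir f i) =
  if cm_base f (cm_dir f i) then 1 - x 0 i else x 0 i.
Proof.
rewrite mxE; case: pickP => [k /eqP/cm_dir_inj -> //|/(_ i)].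
by rewrite eqxx.
Qed.

Lemma cm_point_nodir m n (f : cubemap m n) (x : 'rV[R]_m) j :
  (forall i, cm_dir f i != j) -> cm_point f x 0 j = (cm_base f j)%:R.
Proof.
move=> nj; rewrite mxE; case: pickP => [k|//].
by rewrite (negPf (nj k)).
Qed.

Lemma offset_cm_point m n (f : cubemap m n) (b : {ffun 'I_m -> bool}) x i :
  offset (cm_vertex f b) (cm_point f x) (cm_dir f i) = offset b x i.
Proof.
rewrite /offset cm_vertex_dir cm_point_dir.
by case: (cm_base f _) (b i) => -[] //=; rewrite opprB addrC subrK.
Qed.

Lemma offset_nodir m n (f : cubemap m n) b x j :
  (forall i, cm_dir f i != j) ->
  offset b (cm_point f x) j = (b j != cm_base f j)%:R.
Proof.
move=> /cm_point_nodir; rewrite /offset => ->.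
by case: (b j) (cm_base f j) => -[] //=; rewrite ?subrr ?subr0.
Qed.

(* For [m = 0] this is the open star of a vertex; the bound 1/2 makes the sets
   of an oriented edge and of its reverse disjoint. *)
Definition near_face m n (f : cubemap m n) (y : 'rV[R]_n) : Prop :=
  (forall i, 0 < offset (cm_base f) y (cm_dir f i) < 2^-1) /\
  (forall j, offset (cm_base f) y j < 1).

(** Coordinates along [g] keep their offsets, and the remaining ones have offset 0. *)
Lemma near_face_comp k m n (g : cubemap m n) (f : cubemap k m) x :
  near_face (cm_comp g f) (cm_point g x) <-> near_face f x.
Proof.
rewrite /near_face /=; split=> -[H1 H2]; split=> i.
- by move: (H1 i); rewrite ffunE offset_cm_point.
- by move: (H2 (cm_dir g i)); rewrite offset_cm_point.
- by rewrite ffunE offset_cm_point.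
- have [[k' <-]|/forallNP ni] := pselect (exists k', cm_dir g k' = i).
    by rewrite offset_cm_point.
  have {}ni k' : cm_dir g k' != i by apply/eqP.
  by rewrite offset_nodir // cm_vertex_nodir // eqxx ltr01.
Qed.

(** Coordinates transverse to [g] have offset 0 or 1 from any vertex. Neither is allowed in a
    direction of [h], and excluding 1 forces the base of [h] onto the face [g]. *)
Lemma near_face_factor k m n (g : cubemap m n) (h : cubemap k n) x :
  near_face h (cm_point g x) -> exists f, h = cm_comp g f.
Proof.
move=> [hdir hbase].
have /choice[F FP] : forall i, exists j, cm_dir g j = cm_dir h i.
  move=> i; apply: contrapT => /forallNP ni.
  have := hdir i; rewrite offset_nodir; last by move=> j; apply/eqP.
  case: (_ != _) => /=; rewrite ?ltxx // => /andP[_].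
  by rewrite invf_gt1 ?ltr0n // ltrn1.
have F_inj : injectiveb [ffun i => F i].
  apply/injectiveP => i j; rewrite !ffunE => Fij.
  by apply: (@cm_dir_inj _ _ h); rewrite -!FP Fij.
pose b := [ffun j => cm_base h (cm_dir g j) (+) cm_base g (cm_dir g j)].
exists (Cubemap b F_inj).
apply: cubemap_eq; apply/ffunP => j /=; last by rewrite !ffunE FP.
have [[i <-]|/forallNP nj] := pselect (exists i, cm_dir g i = j).
  by rewrite cm_vertex_dir ffunE addbC addbK.
have {}nj i : cm_dir g i != j by apply/eqP.
rewrite cm_vertex_nodir //; have := hbase j; rewrite offset_nodir //.
by case: eqVneq => //= _; rewrite ltxx.
Qed.

Lemma near_face_open m n (f : cubemap m n) :
  open [set y : 'rV[R]_n | near_face f y].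
Proof.
have cont j : continuous (fun y : 'rV[R]_n => offset (cm_base f) y j).
  move=> y; rewrite /offset; case: (cm_base f j); last exact: coord_continuous.
  apply: (@continuousB _ R^o _ (fun=> 1) (fun z : 'rV[R]_n => z 0 j)).
    exact: cst_continuous.
  exact: coord_continuous.
rewrite openE => y [H1 H2]; rewrite /interior /near_face.
have N1 : \forall z \near y,
    forall i, 0 < offset (cm_base f) z (cm_dir f i) < 2^-1.
  apply: (@filter_forall _ _ (fun i z =>
    0 < offset (cm_base f) z (cm_dir f i) < 2^-1) (nbhs y)) => i.
  have /andP[l u] := H1 i.
  near=> z; apply/andP; split; near: z; first exact: (cvgr_gt _ (cont _ y)).
  exact: (cvgr_lt _ (cont _ y)).
have N2 : \forall z \near y, forall j, offset (cm_base f) z j < 1.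
  apply: (@filter_forall _ _ (fun j z => offset (cm_base f) z j < 1)
    (nbhs y)) => j.
  by apply: (cvgr_lt _ (cont _ y)).
exact: filterI N1 N2.
Unshelve. all: by end_near. Qed.

(** * Stars in the realization and the action of automorphisms on them *)

Variable X : cube_complex.

(** Faces of a cell may be identified, so [d] can occur in it several times; any occurrence [f]
    counts. *)
Definition near_cube m (d : cube X m) (q : cell_points R X) : Prop :=
  let: existT (existT n c) y := q in
  exists2 f : cubemap m n, face f c = d & near_face f (val y).

Lemma near_cube_glued m (d : cube X m) (q q' : cell_points R X) :
  glued q q' -> near_cube d q <-> near_cube d q'.
Proof.
move=> /asboolP; elim=> {q q'} [q q' []|//|q q' _ -> //|q q' q'' _ -> _ -> //].
move=> k n g c x y /= ->; split=> [[f fd xf]|[h hd yh]].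
  by exists (cm_comp g f); [rewrite face_comp|apply/near_face_comp].
have [f hE] := near_face_factor yh; exists f; first by rewrite -face_comp -hE.
by move: yh; rewrite hE near_face_comp.
Qed.

Definition star m (d : cube X m) : set (realization R X) :=
  [set z | near_cube d (repr z)].

Lemma starP m (d : cube X m) (q : cell_points R X) :
  star d (\pi_(realization R X)%qT q) <-> near_cube d q.
Proof.
apply: near_cube_glued; have := reprK (\pi_(realization R X)%qT q).
by move=> /eqquotP.
Qed.

Lemma star_open m (d : cube X m) : open (star d).
Proof.
have : open [set q | near_cube d q].
  apply/sigT_openP => -[n c].
  exists (\bigcup_(f in [set f : cubemap m n | face f c = d])
    [set y : 'rV[R]_n | near_face f y]).
    by apply: bigcup_open => f _; apply: near_face_open.
  rewrite eqEsubset; split=> y /=.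
    by move=> [f fd yf]; exists f.
  by move=> [f fd yf]; exists f.
by congr open; rewrite predeqE => q; apply: iff_sym; apply: starP.
Qed.

Lemma star_aut m (d : cube X m) (g : aut X) z :
  star d (aut_realization g z) <-> star ((g^-1)%g m d) z.
Proof.
rewrite /aut_realization {2}/star /mkset.
case: (repr z) => -[n c] y; rewrite starP.
split=> -[f fd yf]; exists f => //; first by rewrite -fd -aut_face autK.
by rewrite -aut_face fd autVK.
Qed.

Lemma star_cover (z : realization R X) : exists v : vertex X, star v z.
Proof.
rewrite /star /mkset; case: (repr z) => -[n c] y /=.
(* Rounding each coordinate to the nearer endpoint keeps all offsets at most 1/2. *)
pose b := [ffun j => 2^-1 < val y 0 j].
exists (face (cm_vtx b) c); exists (cm_vtx b) => //; split=> [[]//|j].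
rewrite /offset /= ffunE; have [yj|yj] := ltP 2^-1 (\val y 0 j).
  by rewrite ltrBlDr ltrDl; apply: lt_trans yj; rewrite invr_gt0.
by apply: le_lt_trans yj _; rewrite invf_lt1 ?ltr1n.
Qed.

Lemma third_in_unit_cube m : unit_cube R m (const_mx 3^-1 : 'rV[R]_m).
Proof. by move=> i; rewrite mxE invr_ge0 ler0n invf_le1 ?ler1n. Qed.

(** For an edge, a coordinate below 1/2 marks the half at the start, so that this point records the
    orientation; for a vertex it is the vertex itself. *)
Definition third_point m (d : cube X m) : realization R X :=
  \pi_(realization R X)%qT
    (cell_point d (exist (fun x => x \in unit_cube R m) _
      (mem_set (@third_in_unit_cube m)))).

(* Fails for [m = 2], where the third point is symmetric. *)
Lemma star_third m (d d' : cube X m) : (m <= 1)%N ->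
  star d' (third_point d) <-> d = d'.
Proof.
move=> m1; have ordE (i j : 'I_m) : i = j.
  have lt0 (k : 'I_m) : nat_of_ord k = 0%N.
    by apply/eqP; rewrite -leqn0 -ltnS (leq_trans (ltn_ord k)).
  by apply: val_inj; rewrite /= !lt0.
rewrite starP; split=> [[f fd [yf _]]|->].
  rewrite -fd -[LHS]face_id; congr (face _ d).
  apply: cubemap_eq; apply/ffunP => i.
    (* A reversed parametrization would have offset 2/3, which exceeds 1/2. *)
    have := yf i; rewrite (ordE (cm_dir f i) i) /offset /= ffunE.
    case: (cm_base f i) => //; rewrite mxE => /andP[_].
    by lra.
  by rewrite ffunE; apply: ordE.
exists (cm_id m); first exact: face_id.
by split=> i; rewrite /offset /= ffunE mxE; lra.
Qed.

Lemma compact_stars (K : set (realization R X)) : compact K ->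
  exists2 F : set (vertex X), finite_set F &
    forall z, K z -> exists2 v, F v & star v z.
Proof.
have [[z0 _]|/forallNP K0] := pselect (exists z, K z); last first.
  by move=> _; exists set0 => [|z /K0].
(* [compact_cover] is only stated for pointed spaces. *)
pose T := HB.pack_for ptopologicalType (realization R X)
  (isPointed.Build (realization R X) z0).
move=> cK; have : @compact T K by exact: cK.
rewrite compact_cover.
move=> /(_ {classic (vertex X)} setT (fun v => star (v : vertex X))).
case=> [v _|z _|D _ KD]; first exact: star_open.
  by have [v zv] := star_cover z; exists v.
exists ([set` D] : set {classic (vertex X)}).
  exact: (@finite_fset {classic (vertex X)}).
by move=> z /KD[v Dv vz]; exists v.
Qed.

(** Each vertex, as a point, lies in no vertex star but its own, so a finite subcover by stars
    contains every vertex. *)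
Lemma compact_finite_vertices :
  compact [set: realization R X] -> finite_set [set: vertex X].
Proof.
move=> /compact_stars[F finF FP]; apply: sub_finite_set finF => v _.
by have [//|w Fw /(star_third _ _ (leq0n 1)) ->] := FP (third_point v).
Qed.

Lemma aut_realization_star (v : vertex X) (g : aut X) (z : realization R X) :
  star v z -> (forall n (c : cube X n), corner c = v -> g n c = c) ->
  aut_realization g z = z.
Proof.
move=> vz gv; rewrite -[RHS]reprK /aut_realization.
move: vz; rewrite /star /mkset; case: (repr z) => -[n c] y [f fv _].
congr (\pi_(realization R X)%qT (cell_point _ _)).
(* The reflection of the cube that makes [v] its corner; as an involution it transfers fixedness of
   the reflected cube back to [c]. *)
pose phi := Cubemap (cm_base f) (id_dir_inj n).
have phiK : cm_comp phi phi = cm_id n.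
  apply: cubemap_eq; apply/ffunP => i; last by rewrite !ffunE.
  have {1}<- : cm_dir phi i = i by rewrite ffunE.
  by rewrite cm_vertex_dir [RHS]ffunE [cm_dir phi i]ffunE; apply: addbb.
have {gv} := gv _ (face phi c); rewrite aut_face => gphi.
rewrite -[LHS]face_id -phiK face_comp gphi -?face_comp ?phiK ?face_id //.
by rewrite corner_face -fv; congr (face _ c); apply: cubemap0_eq.
Qed.

(** The condition says that the image of the compact set consisting of the third point of [c] lies
    in the open star of [d]. *)
Lemma open_aut_value m (c d : cube X m) : (m <= 1)%N ->
  open [set g : aut_compact_open X R | (g : aut X) m c = d].
Proof.
move=> m1; exists [set f : {compact-open, realization R X -> realization R X} |
    f @` [set third_point c] `<=` star d].
  by apply: compact_open_open; [exact: compact_set1|exact: star_open].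
rewrite predeqE => g; split=> [gc|<- _ [_ -> <-]].
  have /star_aut/(star_third _ _ m1) -> :
      star d (aut_realization g (third_point c)).
    by apply: gc; exists (third_point c).
  exact: autVK.
by apply/star_aut/(star_third _ _ m1); rewrite autK.
Qed.

(** * Discreteness against finiteness of vertex stabilizers *)

Hypothesis cube_eq : forall n (c d : cube X n),
  corner c = corner d -> axis c =1 axis d -> c = d.
Hypothesis locally_finite :
  forall v : vertex X, finite_set [set e : edge X | start e = v].
Hypothesis path_connected :
  forall v w : vertex X, exists s, edge_path v s w.

(** Near [g] the value at [o] is constant, which leaves a finite coset; each other element of it is
    excluded by the value at one edge. *)
Lemma discrete_finite_stabilizer (o : vertex X) :
  finite_set (stabilizer o) -> aut_discrete X R.
Proof.
move=> fo; suff nbhs1 (g : aut_compact_open X R) : nbhs g [set g].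
  move=> A; rewrite openE => g Ag.
  by apply: filterS (nbhs1 g) => _ ->.
have value m (c : cube X m) : (m <= 1)%N ->
    \forall h \near g, (h : aut X) m c = (g : aut X) m c.
  by move=> m1; apply: open_nbhs_nbhs; split=> //; apply: open_aut_value.
have /finite_seqP[s sE] := finite_coset ((g : aut X) 0 o) fo.
have near_s (t : seq (aut X)) :
    (forall h, h \in t -> h 0 o = (g : aut X) 0 o) ->
    \forall h \near g, (h : aut X) \in t -> h = g.
  elim: t => [|k t IHt] tP; first exact: filterE.
  have {}IHt : \forall h \near g, (h : aut X) \in t -> h = g.
    by apply: IHt => h ht; apply: tP; rewrite inE ht orbT.
  have [->|kg] := pselect (k = g).
    by apply: filterS IHt => h hg; rewrite inE => /orP[/eqP|/hg].
  have [e ke] : exists e, k 1 e <> (g : aut X) 1 e.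
    apply/existsNP => kgE; apply: kg; apply: (@aut_eq _ path_connected o).
    by move=> r; apply: agree_on_vball; rewrite ?tP ?mem_head.
  apply: filterS (filterI IHt (value _ e isT)) => h [hg he].
  by rewrite inE => /orP[/eqP hk|/hg //]; case: ke; rewrite -hk.
have s_coset h : h \in s <-> h 0 o = (g : aut X) 0 o.
  by have := congr1 (fun A : set (aut X) => A h) sE => /= ->.
have near_fibre := near_s s (fun h => (s_coset h).1).
apply: filterS (filterI (value 0%N o isT) near_fibre) => h [/s_coset hs].
by apply.
Qed.

(** If the identity is isolated, some ball around [o] has only the identity acting trivially on it,
    which an infinite stabilizer forbids. *)
Lemma finite_stabilizer_discrete (o : vertex X) :
  aut_discrete X R -> finite_set (stabilizer o).
Proof.
move=> disc; apply: contrapT => inf.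
have [A oA A1] := disc [set (1%g : aut X)].
(* The filter generated by the automorphisms trivial on larger and larger balls. It converges to the
   identity: a compact set meets only what finitely many vertex stars cover, and these are fixed
   pointwise once the ball contains their vertices. *)
pose F : set_system {compact-open, realization R X -> realization R X} :=
  [set B | exists r, forall g : aut X,
    agree_on (vball o r) g 1%g -> B (@aut_realization X R g)].
have FF : Filter F.
  split=> [|B C [r rB] [s sC]|B C BC [r rB]]; first by exists 0%N.
    exists (maxn r s) => g g1; split; [apply: rB|apply: sC].
      by apply: agree_sub g1; apply: vball_le; apply: leq_maxl.
    by apply: agree_sub g1; apply: vball_le; apply: leq_maxr.
  by exists r => g /rB/BC.
have Fcvg : F --> (@aut_realization X R 1%g :
    {compact-open, realization R X -> realization R X}).
  apply/compact_open_cvgP => K U cK oU KU.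
  have [V finV KV] := compact_stars cK.
  have [r Vr] := finite_sub_vball path_connected o finV.
  exists r => g g1 _ [z Kz <-]; have [v /Vr vr vz] := KV _ Kz.
  rewrite (aut_realization_star vz) => [|n c cv]; last by rewrite g1 // cv.
  by apply: KU; exists z => //; apply: aut_realization_star vz _ => n c _.
have [r rA] : F A.
  apply: Fcvg; apply: open_nbhs_nbhs; split=> //.
  by have : [set (1%g : aut X)] 1%g by []; rewrite -A1.
have [k [_ k1 kN1]] := stab_agree1 cube_eq locally_finite r inf.
apply: kN1; have := rA k k1.
by rewrite -[A _]/((@aut_realization X R @^-1` A) k) A1.
Qed.

End CubePoints.

(** * The alternatives, decided by the finiteness of one vertex stabilizer *)

Theorem theorem4 (R : realType) (S : cube_complex)
  (S_compact : compact [set: realization R S])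
  (S_connected : connected [set: realization R S])
  (S_npc : nonpositively_curved S) (S_special : special S)
  (X : cube_complex) (p : cubical_map X S) (p_universal : universal_covering p)
  (Sig0 : finType) (inv : Sig0 -> Sig0)
  (invK : involutive inv) (inv_fixfree : forall s, inv s <> s)
  (l : edge X -> Sig0) (l_admissible : admissible inv l)
  (l_invariant : forall (g : aut X) (e : edge X),
     deck_transformation p g -> l (g 1%N e) = l e)
  (l_appears : exists o : vertex X,
     forall (u : seq {set Sig0}) (vs : seq (vertex X)),
       reduced l o u -> u <> [::] -> spells l o vs u ->
       forall sigma : Sig0 -> Sig0,
         label_morphism l (last o vs) sigma ->
         compatible l o u (last o vs) sigma ->
         appears l o (last o vs) sigma) :
  let fg_with_finite_stabilizers :=
    finitely_generated (aut X) /\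
    (forall v : vertex X, finite_set (stabilizer v)) in
  let nondiscrete := ~ aut_discrete X R in
  (fg_with_finite_stabilizers /\ ~ nondiscrete \/
   ~ fg_with_finite_stabilizers /\ nondiscrete) /\
  ((forall v : vertex X, ~ countable (stabilizer v)) \/
   (forall v : vertex X, finite_set (stabilizer v))).
Proof.
have [v0 _] := l_appears; move: p_universal => [p_cover X_sc].
have cube_eq := covering_cube_eq p_cover S_npc.
have path_connected := X_sc.1.
have locally_finite (v : vertex X) : finite_set [set e : edge X | start e = v].
  (* One evaluation, indexed by [unit], is enough: by (A2) an edge at [v] is determined by its label
     in the finite [Sig0]. *)
  apply: (@finite_set_separated _ unit _ (fun e _ => l e) _ setT setT) => //.
  move=> e f /= ev fv ef; apply: (adm_inj l_admissible); first by rewrite ev.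
  exact: ef tt I.
(* One chosen vertex over each of the finitely many vertices of [S] gives a finite set meeting every
   orbit. *)
have /choice[sec secK] := p_cover.1.
have cofinite (v : vertex X) : exists g : aut X, range sec (g 0%N v).
  have [g gv] := fibre_transitive p_cover X_sc (esym (secK (p 0%N v))).
  by exists g; rewrite gv; exists (p 0%N v).
have fin_range : finite_set (range sec).
  exact/finite_image/(compact_finite_vertices S_compact).
have [fin0|inf] := pselect (finite_set (stabilizer v0)).
  have fin v := finite_stabilizer locally_finite path_connected v fin0.
  split; last by right.
  left; split; first split=> //.
    exact: finitely_generated_cofinite fin0 fin_range cofinite.
  by apply; apply: discrete_finite_stabilizer fin0.
split; [right; split|left] => [[_ /(_ v0)]//| |v].
  by move=> /(finite_stabilizer_discrete cube_eq locally_finite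
                path_connected v0).
apply: stabilizer_uncountable => // fv; apply: inf.
exact: finite_stabilizer fv.
Qed.
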